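(* Let $G$ be a maximal outerplanar graph with at least one separator triangle ($t\ge 1$) such that the subgraph $G_{\triangle}$ formed by its separator triangles is connected (has exactly one component). Then $Z(G)\ge \left\lceil \frac{n_2}{2}\right\rceil$, where $n_2$ is the number of vertices of degree $2$ in $G$.
   Context: A MOP (maximal outerplanar graph) is an outerplanar graph to which no edge can be added while preserving outerplanarity; all bounded faces of its outerplanar drawing are triangles. A separator triangle is a bounded triangular face none of whose edges lies on the outer face; $t$ is the number of separator triangles, and $G_{\triangle}$ is the subgraph of $G$ that is the union of all separator triangles. Zero forcing: color a set $S$ blue and the rest white; repeatedly, if $w$ is the only white neighbor of a blue vertex, color $w$ blue. $S$ is a zero forcing set if eventually all vertices are blue, and $Z(G)$ is the minimum size of a zero forcing set. *)

(* Defs.v *)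
From mathcomp Require Import all_boot all_fingroup.

Set Implicit Arguments.
Unset Strict Implicit.
Unset Printing Implicit Defensive.

(* A simple graph is a symmetric irreflexive relation e on a finite type T.   *)

Section Graphs.

Variables (T : finType) (e : rel T).

Definition neighbors (v : T) : {set T} := [set w | e v w].

Definition num_deg2 : nat := #|[set v | #|neighbors v| == 2]|.

Definition add_edge (x y : T) : rel T :=
  fun u v => [|| e u v, (u == x) && (v == y) | (u == y) && (v == x)].

(* Plane embeddings are represented combinatorially.  An edge {u, v} carries  *)
(* the two darts (u, v), from u to v, and (v, u).  A rotation system gives    *)
(* the cyclic order (rot v) of the neighbors of v around v in the drawing;    *)
(* the values of rot v outside of the neighborhood of v are irrelevant.       *)

Definition darts : {set T * T} := [set d | e d.1 d.2].

Definition rotation_system (rot : T -> {perm T}) : Prop :=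
  forall v u : T, e v u -> porbit (rot v) u = neighbors v.

(* The boundary walk of a face arrives at v from u along (u, v), and leaves v *)
(* along the edge that follows {u, v} in the rotation at v.                   *)

Definition face_next (rot : T -> {perm T}) (d : T * T) : T * T :=
  (d.2, rot d.2 d.1).

Definition facial_walk (rot : T -> {perm T}) (d : T * T) : {set T * T} :=
  [set d' | fconnect (face_next rot) d d'].

Definition facial_walks (rot : T -> {perm T}) : {set {set T * T}} :=
  [set facial_walk rot d | d in darts].

(* The embedding is in the sphere (equivalently, the plane) when Euler's      *)
(* formula V - E + F = 2 holds in every component.  Each component has        *)
(* V - E + F <= 2, so it is enough that the sum over the components be twice  *)
(* their number.  An isolated vertex has one face, but no dart, hence the     *)
(* separate term.                                                             *)

Definition genus0 (rot : T -> {perm T}) : Prop :=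
  #|T| + (#|facial_walks rot| + #|[set v | neighbors v == set0]|)
  = #|darts|./2 + (n_comp e T).*2.

(* outer is the set of darts along the outer face.  The boundary of the outer *)
(* face consists of one facial walk for each component of the graph (a        *)
(* trivial one, without darts, for an isolated vertex), because all the       *)
(* vertices are required to be on the outer face.                             *)

Definition outerplane_embedding (rot : T -> {perm T}) (outer : {set T * T})
    : Prop :=
  [/\ rotation_system rot,
      genus0 rot,
      outer \subset darts,
      {in outer, forall d, [set d' in outer | connect e d.1 d'.1]
                           = facial_walk rot d}
    & forall v, neighbors v != set0 -> exists u, (v, u) \in outer].

Definition on_outer_face (outer : {set T * T}) (d : T * T) : bool :=
  (d \in outer) || ((d.2, d.1) \in outer).

(* In an outerplane embedding, each bounded face has a single facial walk;    *)
(* it is a triangle when this walk has length 3.                              *)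

Definition bounded_faces (rot : T -> {perm T}) (outer : {set T * T})
    : {set {set T * T}} :=
  [set F in facial_walks rot | [disjoint F & outer]].

Definition separator_triangles (rot : T -> {perm T}) (outer : {set T * T})
    : {set {set T * T}} :=
  [set F in bounded_faces rot outer |
     (#|F| == 3) && [forall d in F, ~~ on_outer_face outer d]].

(* The vertices and the edges of the union of the separator triangles. *)

Definition Gtri_vertices (rot : T -> {perm T}) (outer : {set T * T})
    : {set T} :=
  [set d.1 | d in cover (separator_triangles rot outer)].

Definition Gtri_edge (rot : T -> {perm T}) (outer : {set T * T}) : rel T :=
  fun u v => ((u, v) \in cover (separator_triangles rot outer))
          || ((v, u) \in cover (separator_triangles rot outer)).

Definition Gtri_components (rot : T -> {perm T}) (outer : {set T * T}) : nat :=
  n_comp (Gtri_edge rot outer) (Gtri_vertices rot outer).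

(* B is the set of blue vertices: a blue v forces its only white neighbor w. *)

Definition force_step : rel {set T} :=
  fun B B' => [exists v in B, exists w,
                 (neighbors v :\: B == [set w]) && (B' == w |: B)].

Definition zero_forcing_set (S : {set T}) : bool :=
  connect force_step S [set: T].

Definition zero_forcing_number : nat :=
  #|[arg min_(S < [set: T] | zero_forcing_set S) #|S|]|.

End Graphs.

Definition outerplanar (T : finType) (e : rel T) : Prop :=
  exists rot outer, outerplane_embedding e rot outer.

Definition maximal_outerplanar (T : finType) (e : rel T) : Prop :=
  outerplanar e /\
  forall x y : T, x != y -> ~~ e x y -> ~ outerplanar (add_edge e x y).

(* Main.v *)
(* A vertex v of degree 2 in a MOP has adjacent neighbors a and b: otherwise  *)
(* the chord ab could be drawn along the path a, v, b, on one side of v,      *)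
(* without cutting any vertex off the outer face.  In a zero forcing process, *)
(* a vertex w forced by u therefore never forces if it has degree 2: it could *)
(* only force its other neighbor, which is adjacent to u and hence already    *)
(* blue.  So each of the #|S| forcing chains contains at most two vertices of *)
(* degree 2, its ends.                                                        *)

Require Import Defs.
From mathcomp Require Import all_boot all_fingroup.

Set Implicit Arguments.
Unset Strict Implicit.
Unset Printing Implicit Defensive.

(** The bound is a count on forcing chains: in [zero_forcing_deg2] the vertices of degree 2 are
    covered by the starts of the chains, which form [S], and by their ends, the vertices that never
    force; there are [#|S|] of each. This rests on [deg2_neighbors_adjacent], where maximality
    enters: if the two neighbors of a vertex of degree 2 were not adjacent, [outerplanar_add_chord]
    would give a larger outerplanar graph. Most of the work is to draw this chord in a rotation
    system. Along one facial walk two darts are replaced by a single one ([bypass_orbit]), distinct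
    walks stay distinct ([bypass_orbit_inj]), and one triangle appears, so that one more face
    balances one more edge in Euler's formula. *)

Lemma fconnect_stable (D : finType) (f : D -> D) (B : {set D}) x y :
  {in B, forall z, f z \in B} -> x \in B -> fconnect f x y -> y \in B.
Proof.
move=> fB xB /iter_findex <-; elim: (findex f x y) => //= n; exact: fB.
Qed.

Lemma porbit_stable (D : finType) (s : {perm D}) (B : {set D}) x y :
  {in B, forall z, s z \in B} -> x \in B -> y \in porbit s x -> y \in B.
Proof.
move=> sB xB /porbitP[n ->].
by elim: n => [|n IHn]; rewrite ?expg0 ?perm1 // expgSr permM sB.
Qed.

Lemma porbit_step (D : finType) (s : {perm D}) x z :
  (s z \in porbit s x) = (z \in porbit s x).
Proof. by rewrite porbit_sym -{2}[s]expg1 porbit_perm porbit_sym. Qed.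

(** * Inserting a new neighbor into a rotation *)

Section InsertInCycle.

Variables (D : finType) (s : {perm D}) (x y : D).
Hypothesis xy : y \notin porbit s x.

(** Splices [y] into the cycle of [x], right after [x]. As [y] may come from any other cycle of [s],
    the last factor closes up the cycle that it leaves. *)
Definition perm_insert : {perm D} := (tperm x y * s * tperm y (s y))%g.

Lemma perm_insertL : perm_insert x = y.
Proof. by rewrite !permM tpermL tpermR. Qed.

Let insert_out z : z \in porbit s x -> tperm y (s y) (s z) = s z.
Proof.
rewrite -porbit_step => zO; rewrite tpermD //; apply: contraNneq xy => eqy.
  by rewrite eqy.
by rewrite -porbit_step eqy.
Qed.

Lemma perm_insertR : perm_insert y = s x.
Proof. by rewrite !permM tpermR insert_out ?porbit_id. Qed.

Lemma perm_insertD z : z \in porbit s x -> z != x -> perm_insert z = s z.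
Proof.
move=> zO zx; have yz : y != z by apply: contraNneq xy => ->.
by rewrite eq_sym in zx; rewrite !permM (tpermD zx yz) insert_out.
Qed.

Lemma porbit_insert z :
  z \in y |: porbit s x -> porbit perm_insert z = y |: porbit s x.
Proof.
move=> zO; suff xO: porbit perm_insert x = y |: porbit s x.
  by rewrite -xO in zO *; apply/eqP; rewrite eq_porbit_mem.
have sub u : u \in porbit perm_insert x -> u \in y |: porbit s x.
  apply: porbit_stable => [w|]; last by rewrite !inE porbit_id orbT.
  rewrite !in_setU1 => /predU1P[-> | wO].
    by rewrite perm_insertR porbit_step porbit_id orbT.
  have [->|wx] := eqVneq w x; first by rewrite perm_insertL eqxx.
  by rewrite perm_insertD // porbit_step wO orbT.
have yO : y \in porbit perm_insert x.
  by rewrite -perm_insertL porbit_step porbit_id.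
apply/setP => u; apply/idP/idP; first exact: sub.
rewrite in_setU1 => /predU1P[-> // | uO].
(* With [y] removed, the new orbit is closed under [s]: the detour from [x] through [y] to [s x]
   becomes one step. Hence it contains the [s]-orbit of [x]. *)
suff: u \in porbit perm_insert x :\ y by case/setD1P.
apply: porbit_stable uO; last first.
  by rewrite !inE porbit_id andbT; apply: contraNneq xy => <-; rewrite porbit_id.
move=> w /setD1P[wy wO].
have wS : w \in porbit s x by move: (sub _ wO); rewrite in_setU1 (negPf wy).
rewrite in_setD1; apply/andP; split.
  by apply: contraNneq xy => <-; rewrite porbit_step.
have [->|wx] := eqVneq w x; first by rewrite -perm_insertR porbit_step.
by rewrite -perm_insertD // porbit_step.
Qed.

End InsertInCycle.

(** * Effect of a shortcut on the orbits of a map *)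

Section Bypass.

Variables (D : finType) (f g : D -> D) (A : {set D}) (p s1 s2 m : D).
Hypotheses (f_inj : injective f) (fA : {in A, forall d, f d \in A}).
Hypotheses (s12 : s1 != s2) (ps2 : p != s2) (mA : m \notin A).
Hypotheses (fp : f p = s1) (fs1 : f s1 = s2) (gp : g p = m) (gm : g m = f s2).
Hypothesis fg : {in A, forall d, d != p -> d != s2 -> g d = f d}.

Let f_notin z : (f z \notin [set s1; s2]) = (z != p) && (z != s1).
Proof.
by rewrite -(inj_eq f_inj z p) -(inj_eq f_inj z s1) fp fs1 !inE negb_or.
Qed.

(* The orbit of [f] through p, s1, s2, f s2 becomes the orbit of [g] through   *)
(* p, m, f s2; all other orbits in [A] are unchanged.                         *)
Definition bypass (X : {set D}) : {set D} :=
  if s1 \in X then m |: X :\: [set s1; s2] else X.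

Let s2X x : fconnect f x s1 = fconnect f x s2.
Proof.
by rewrite -fs1 (fconnect_sym f_inj) (fconnect_sym f_inj x) same_fconnect1.
Qed.

Lemma in_bypass x d : d \in A ->
  (d \in bypass [set z | fconnect f x z])
  = (d \notin [set s1; s2]) && fconnect f x d.
Proof.
move=> dA; rewrite /bypass !inE; have dm : d != m by apply: contraNneq mA => <-.
case: ifP => xs1; rewrite !inE ?(negPf dm) //=.
have [->|] := eqVneq d s1; first by [].
have [->|//] := eqVneq d s2; by rewrite -s2X xs1.
Qed.

Lemma mem_bypass x : x \in A ->
  (m \in bypass [set z | fconnect f x z]) = fconnect f x s1.
Proof.
move=> xA; rewrite /bypass inE; case: ifP => _; first by rewrite in_setU1 eqxx.
by apply: contraNF mA; rewrite inE; apply: fconnect_stable xA.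
Qed.

(** An orbit is the least set that contains [x] and is closed under the map, so each inclusion
    amounts to a closure property: of [bypass X] under [g], then of a set built from [Y] under
    [f]. *)
Lemma bypass_orbit x : x \in A -> x \notin [set s1; s2] ->
  [set z | fconnect g x z] = bypass [set z | fconnect f x z].
Proof.
move=> xA xs; set X := [set z | fconnect f x z].
set Y := [set z | fconnect g x z].
have XA z : z \in X -> z \in A by rewrite inE; apply: fconnect_stable xA.
have mX : m \in bypass X = (s1 \in X) by rewrite mem_bypass // inE.
have fX z : z \in X -> f z \in X.
  by rewrite !inE => /connect_trans; apply; apply: fconnect1.
have YX z : z \in Y -> z \in bypass X.
  rewrite inE; apply: fconnect_stable; last by rewrite in_bypass // xs connect0.
  move=> w wX; have [wm|wm] := eqVneq w m.
    have s1X: s1 \in X by rewrite -mX -wm.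
    have s2X': s2 \in X by rewrite -fs1 fX.
    rewrite wm gm in_bypass ?fA ?XA //; move: (fX _ s2X'); rewrite inE => ->.
    by rewrite andbT f_notin eq_sym ps2 eq_sym s12.
  have {wX} [wX ws] : w \in X /\ w \notin [set s1; s2].
    move: wX; rewrite /bypass; case: ifP => s1X.
      by rewrite in_setU1 (negPf wm) in_setD => /andP[].
    move=> wX; split => //; rewrite !inE negb_or; apply/andP; split.
      by apply: contraFneq s1X => <-.
    by apply: contraFneq s1X => ew; rewrite inE s2X -ew -in_set.
  have [wp|wp] := eqVneq w p; first by rewrite wp gp mX -fp fX -?wp.
  move: ws; rewrite !inE negb_or => /andP[ws1 ws2].
  rewrite fg ?XA // in_bypass ?fA ?XA //; move: (fX _ wX); rewrite inE => ->.
  by rewrite f_notin wp ws1.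
have gY z : z \in Y -> g z \in Y.
  by rewrite !inE => /connect_trans; apply; apply: fconnect1.
(* [B] undoes the bypass on [Y], putting [s1] and [s2] back in place of [m]; its intersection with
   [X] is closed under [f]. *)
pose B := Y :\ m :|: (if m \in Y then [set s1; s2] else set0).
have XB z : z \in X -> (z \in B) && (z \in X).
  rewrite -in_setI inE; apply: fconnect_stable; last first.
    rewrite !inE !connect0 !andbT; apply/orP; left.
    by apply: contraNneq mA => <-.
  move=> w /setIP[wB wX]; rewrite in_setI fX // andbT.
  have fwm : f w != m by apply: contraNneq mA => <-; rewrite fA ?XA.
  move: wB; rewrite in_setU => /orP[/setD1P[wm wY] |].
    have [wp|wp] := eqVneq w p.
      by rewrite wp fp /B -gp gY -?wp // !inE eqxx orbT.
    have [ws2|ws2] := eqVneq w s2.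
      have := YX _ wY; rewrite in_bypass ?XA // ws2.
      by rewrite !inE eqxx orbT.
    by rewrite in_setU in_setD1 fwm -fg ?gY // XA.
  case: ifP => mY; last by rewrite in_set0.
  rewrite in_set2 => /orP[]/eqP ew.
    by rewrite in_setU mY ew fs1 !inE eqxx !orbT.
  by rewrite in_setU in_setD1 fwm ew -gm gY.
apply/setP => z; apply/idP/idP; first exact: YX.
have [->|zm] := eqVneq z m.
  rewrite mX => s1X; have /andP[] := XB _ s1X.
  rewrite in_setU => /orP[/setD1P[_ /YX]|].
    by rewrite in_bypass ?XA // in_set2 eqxx.
  by case: ifP => // _; rewrite in_set0.
move=> zX; have {zX} [zX zs] : z \in X /\ z \notin [set s1; s2].
  have zA : z \in A.
    move: zX; rewrite /bypass; case: ifP => _; last exact: XA.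
    by rewrite in_setU1 (negPf zm) => /setDP[/XA].
  by move: zX; rewrite in_bypass // => /andP[? ?]; rewrite inE.
move: (XB _ zX); rewrite in_setU in_setD1 => /andP[/orP[/andP[] //|]].
by case: ifP => _; rewrite ?in_set0 // (negPf zs).
Qed.

(** A point other than [s1] and [s2] survives in its own bypassed orbit and identifies it; the orbit
    of [s1] and [s2] is identified by [m]. *)
Lemma bypass_orbit_inj : {in A &, forall x y,
  bypass [set z | fconnect f x z] = bypass [set z | fconnect f y z] ->
  [set z | fconnect f x z] = [set z | fconnect f y z]}.
Proof.
move=> x y xA yA /setP eq_xy.
suff xy : fconnect f x y.
  by apply/setP => z; rewrite !inE (same_connect (fconnect_sym f_inj) xy).
have [ys|ys] := boolP (y \in [set s1; s2]); last first.
  by have := eq_xy y; rewrite !in_bypass // ys connect0 => /=.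
have ys1 : fconnect f y s1.
  by move: ys; rewrite !inE => /orP[]/eqP->; rewrite ?connect0 // s2X connect0.
have := eq_xy m; rewrite !mem_bypass // ys1 => xs1.
by apply: connect_trans xs1 _; rewrite (fconnect_sym f_inj).
Qed.

End Bypass.

(** * Drawing the chord [ab] along the path [b], [v], [a] *)

Section Chord.

Variables (T : finType) (e : rel T).
Hypotheses (e_sym : symmetric e) (e_irr : irreflexive e).
Variables (rot : T -> {perm T}) (outer : {set T * T}).
Hypothesis emb : outerplane_embedding e rot outer.
Variables v a b : T.
Hypotheses (Nv : neighbors e v = [set a; b]) (ab : a != b) (nab : ~~ e a b).
Hypothesis vb_outer : (v, b) \in outer.

Let rotN u w : e u w -> porbit (rot u) w = neighbors e u.
Proof. by case: emb => rs _ _ _ _; apply: rs. Qed.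

Let eva : e v a. Proof. by move/setP/(_ a): Nv; rewrite !inE eqxx. Qed.
Let evb : e v b. Proof. by move/setP/(_ b): Nv; rewrite !inE eqxx orbT. Qed.
Let eav : e a v. Proof. by rewrite e_sym. Qed.
Let ebv : e b v. Proof. by rewrite e_sym. Qed.
Let nba : ~~ e b a. Proof. by rewrite e_sym. Qed.
Let va : v != a. Proof. by apply: contraTneq eva => ->; rewrite e_irr. Qed.
Let vb : v != b. Proof. by apply: contraTneq evb => ->; rewrite e_irr. Qed.

(** The dart [(w, b)] is the one just before [(b, v)] on its facial walk; [w] is [v] itself when [b]
    has degree 1. *)
Let w := (rot b)^-1%g v.

Let rot_bw : rot b w = v. Proof. exact: permKV. Qed.

Let Nb : porbit (rot b) w = neighbors e b.
Proof.
by rewrite -(rotN ebv) -rot_bw -{3}[rot b]expg1 porbit_perm.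
Qed.

Let a_Nb : a \notin porbit (rot b) w. Proof. by rewrite Nb inE. Qed.
Let b_Na : b \notin porbit (rot a) v. Proof. by rewrite rotN // inE. Qed.

Let rot_edge u z : e u z -> e u (rot u z).
Proof.
move=> euz; suff: rot u z \in neighbors e u by rewrite inE.
by rewrite -(rotN euz) porbit_step porbit_id.
Qed.

Let rot_fix x y : e v x -> e v y -> x != y -> rot v x != x.
Proof.
move=> evx evy xy; apply: contra_neq xy => rx.
suff: y \in [set x] by rewrite inE => /eqP.
apply: (@porbit_stable _ (rot v) _ x); rewrite ?set11 //.
  by move=> z /set1P->; rewrite rx set11.
by rewrite rotN // inE.
Qed.

Let rot_va : rot v a = b.
Proof.
have := rot_edge eva; have := rot_fix eva evb ab.
by move/setP/(_ (rot v a)): Nv; rewrite !inE => -> /negPf-> /eqP.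
Qed.

Let rot_vb : rot v b = a.
Proof.
have ba : b != a by rewrite eq_sym.
have := rot_edge evb; have := rot_fix evb eva ba.
by move/setP/(_ (rot v b)): Nv; rewrite !inE => -> /negPf->; rewrite orbF => /eqP.
Qed.

(* The chord is inserted on the side of [v] that need not be outer, in the    *)
(* corners preceding [v] at [b] and following it at [a], so that the new face *)
(* (b, v), (v, a), (a, b) is a triangle.                                      *)
Definition chord_rot (z : T) : {perm T} :=
  if z == a then perm_insert (rot a) v b
  else if z == b then perm_insert (rot b) w a else rot z.

Let e' := add_edge e a b.
Let f := face_next rot.
Let g := face_next chord_rot.

Let rot_a : chord_rot a = perm_insert (rot a) v b.
Proof. by rewrite /chord_rot eqxx. Qed.

Let rot_b : chord_rot b = perm_insert (rot b) w a.
Proof. by rewrite /chord_rot eqxx eq_sym (negPf ab). Qed.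

Let rot_o z : z != a -> z != b -> chord_rot z = rot z.
Proof. by rewrite /chord_rot => /negPf-> /negPf->. Qed.

Let face_next_inj (r : T -> {perm T}) : injective (face_next r).
Proof. by move=> [x y] [x' y'] [/= <-] /perm_inj<-. Qed.

Let N'E z : neighbors e' z =
  if z == a then b |: neighbors e a else
  if z == b then a |: neighbors e b else neighbors e z.
Proof.
apply/setP => u; rewrite inE /e' /add_edge.
have [->|za] := eqVneq z a; first by rewrite !inE (negPf ab) orbF orbC.
have [->|zb] := eqVneq z b; first by rewrite !inE orbC.
by rewrite !inE orbF.
Qed.

Let dartsE' : darts e' = [set (a, b); (b, a)] :|: darts e.
Proof. by apply/setP => -[x y]; rewrite !inE /e' /add_edge /= !xpair_eqE orbC. Qed.

Let chord_rotation : rotation_system e' chord_rot.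
Proof.
move=> z u; have -> : e' z u = (u \in neighbors e' z) by rewrite inE.
rewrite N'E; have [->|za] := eqVneq z a.
  by rewrite rot_a -(rotN eav); apply: porbit_insert.
have [->|zb] := eqVneq z b; first by rewrite rot_b -Nb; apply: porbit_insert.
by rewrite rot_o // inE; apply: rotN.
Qed.

(** The instance of the bypass: after [(w, b)], the walk that went past [v] by [s1] and [s2] now
    takes the chord [m]. *)
Let s1 := (b, v).
Let s2 := (v, a).
Let m := (b, a).
Let s12 : s1 != s2. Proof. by rewrite xpair_eqE negb_and va orbT. Qed.
Let pNs2 : (w, b) != s2. Proof. by rewrite xpair_eqE negb_and [b == a]eq_sym ab orbT. Qed.
Let mA : m \notin darts e. Proof. by rewrite inE. Qed.
Let fp : f (w, b) = s1. Proof. by rewrite /f /face_next rot_bw. Qed.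
Let fs1 : f s1 = s2. Proof. by rewrite /f /face_next rot_vb. Qed.
Let gp : g (w, b) = m. Proof. by rewrite /g /face_next rot_b perm_insertL. Qed.
Let gm : g m = f s2. Proof. by rewrite /g /face_next rot_a perm_insertR. Qed.

Let fA : {in darts e, forall d, f d \in darts e}.
Proof. by move=> [x y]; rewrite !inE /= e_sym => /rot_edge. Qed.

Let fg : {in darts e, forall d, d != (w, b) -> d != s2 -> g d = f d}.
Proof.
move=> [x y]; rewrite inE /= e_sym /g /f /face_next /= => eyx.
case: (eqVneq y a) eyx => [->|ya] eyx.
  rewrite !xpair_eqE eqxx andbT => _ xv.
  by rewrite rot_a perm_insertD // rotN // inE.
case: (eqVneq y b) eyx => [->|yb] eyx.
  rewrite !xpair_eqE eqxx andbT => xw _.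
  by rewrite rot_b perm_insertD // Nb inE.
by rewrite rot_o.
Qed.

Let byp := bypass s1 s2 m.

Let walk_old d : d \in darts e -> d \notin [set s1; s2] ->
  facial_walk chord_rot d = byp (facial_walk rot d).
Proof.
exact: (bypass_orbit (face_next_inj (r := rot)) fA s12 pNs2 mA fp fs1 gp gm fg).
Qed.

Let walk_step (r : T -> {perm T}) d :
  facial_walk r (face_next r d) = facial_walk r d.
Proof. by apply/setP => u; rewrite !inE -same_fconnect1. Qed.

Let walk_m : facial_walk chord_rot m = byp (facial_walk rot s1).
Proof.
rewrite -walk_step -/g gm walk_old; first by rewrite !walk_step -[in RHS]walk_step -/f fs1.
  by rewrite fA // inE.
rewrite !inE /f /s2 /face_next /= !xpair_eqE (negPf ab) /= negb_and.
by rewrite [a == v]eq_sym va.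
Qed.

Let tri := [set s1; s2; (a, b)].

Let walk_tri d : d \in tri -> facial_walk chord_rot d = tri.
Proof.
have g1 : g s1 = s2 by rewrite /g /face_next rot_o // rot_vb.
have g2 : g s2 = (a, b) by rewrite /g /face_next rot_a perm_insertL.
have g3 : g (a, b) = s1.
  by rewrite /g /face_next rot_b perm_insertR // rot_bw.
have W2 : facial_walk chord_rot s2 = facial_walk chord_rot s1 by rewrite -g1 walk_step.
have W3 : facial_walk chord_rot (a, b) = facial_walk chord_rot s1.
  by rewrite -W2 -g2 walk_step.
suff W1 : facial_walk chord_rot s1 = tri.
  by rewrite !inE -orbA => /or3P[]/eqP->; rewrite ?W2 ?W3.
apply/setP => x; apply/idP/idP.
  rewrite inE; apply: fconnect_stable; last by rewrite !inE eqxx.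
  move=> y; rewrite !inE -orbA => /or3P[]/eqP->; rewrite -/g ?g1 ?g2 ?g3 eqxx ?orbT //.
rewrite !inE -orbA => /or3P[]/eqP->; first exact: connect0.
  by rewrite -g1 fconnect1.
by rewrite -g2 -g1; apply: connect_trans (fconnect1 _ _) (fconnect1 _ _).
Qed.

(** The chord splits the face at the corner [s1], [s2] in two: the triangle, and the rest of the old
    walk closed up by [m]. *)
Let chord_walks : facial_walks e' chord_rot = tri |: byp @: facial_walks e rot.
Proof.
have s1A : s1 \in darts e by rewrite inE.
apply/setP => X; apply/imsetP/setU1P => [[d] | [->|/imsetP[_ /imsetP[d dA ->] ->]]].
- rewrite dartsE' => dA ->.
  have [/walk_tri|dt] := boolP (d \in tri); [by left | right].
  have [->|dm] := eqVneq d m.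
    by rewrite walk_m; apply: imset_f; apply: imset_f.
  have {}dA : d \in darts e.
    move: dA dt; rewrite !in_setU !in_set1 (negPf dm) orbF.
    by rewrite !negb_or; case/orP=> // ->; rewrite andbF.
  rewrite walk_old //; first by apply: imset_f; apply: imset_f.
  by move: dt; rewrite in_setU negb_or => /andP[].
- exists s1; first by rewrite dartsE' in_setU s1A orbT.
  by rewrite walk_tri // !inE eqxx.
have [ds|ds] := boolP (d \in [set s1; s2]); last first.
  by exists d; rewrite ?walk_old // dartsE' in_setU dA orbT.
(* The darts [s1] and [s2] now belong to the triangle, so [m] has to represent what remains of their
   old walk. *)
exists m; first by rewrite dartsE' !inE eqxx orbT.
rewrite walk_m; congr byp; move: ds => /set2P[-> // | ->].
by rewrite -fs1 walk_step.
Qed.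

Let card_walks : #|facial_walks e' chord_rot| = #|facial_walks e rot|.+1.
Proof.
rewrite chord_walks cardsU1 card_in_imset; last first.
  move=> _ _ /imsetP[x xA ->] /imsetP[y yA ->].
  exact: (bypass_orbit_inj (face_next_inj (r := rot)) fA mA fs1).
(* The triangle contains [(a, b)], which is not a dart of [e], while a bypass adds at most the
   reverse dart [m]. *)
suff -> : tri \notin byp @: facial_walks e rot by [].
apply/negP => /imsetP[_ /imsetP[x xA ->]] /setP/(_ (a, b)).
rewrite !inE eqxx orbT /byp /bypass.
have abX : (a, b) \notin facial_walk rot x.
  apply: contraNN nab; rewrite inE => /(fconnect_stable fA xA).
  by rewrite inE.
case: ifP => _; last by rewrite (negPf abX).
by rewrite in_setU1 in_setD (negPf abX) andbF orbF xpair_eqE (negPf ab).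
Qed.

Let chord_connect : connect e' =2 connect e.
Proof.
have sub : subrel e e' by move=> x y exy; rewrite /e' /add_edge exy.
move=> x y; apply/idP/idP; last first.
  by apply: connect_sub => ? ? /sub /connect1.
apply: connect_sub => {x y} x y; rewrite /e' /add_edge.
have cab : connect e a b by apply: connect_trans (connect1 eav) (connect1 evb).
case/or3P => [/connect1 // | /andP[/eqP-> /eqP->] // | /andP[/eqP-> /eqP->]].
by rewrite (sym_connect_sym e_sym).
Qed.

Let chord_isolated z : (neighbors e' z == set0) = (neighbors e z == set0).
Proof.
have nonisolated u x c : e x u -> (c |: neighbors e x == set0) = (neighbors e x == set0).
  move=> exu; apply/idP/idP => /eqP/setP; first by move/(_ c); rewrite !inE eqxx.
  by move/(_ u); rewrite !inE exu.
rewrite N'E; have [->|_] := eqVneq z a; first exact: nonisolated eav.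
by have [->|//] := eqVneq z b; apply: nonisolated ebv.
Qed.

(** There is one more edge and one more face, and the components are unchanged because [a] and [b]
    were already joined through [v]. *)
Let chord_genus0 : genus0 e' chord_rot.
Proof.
case: emb => _ g0 _ _ _; move: g0; rewrite /genus0 card_walks dartsE'.
have -> : [set z | neighbors e' z == set0] = [set z | neighbors e z == set0].
  by apply/setP => z; rewrite !inE chord_isolated.
rewrite (eq_n_comp chord_connect) cardsU disjoint_setI0 ?cards0 ?subn0.
  by rewrite cards2 xpair_eqE (negPf ab) /= => g0; rewrite !addnS !addSn g0.
rewrite disjoint_subset; apply/subsetP => d /set2P[]->; by rewrite !inE.
Qed.

Let walk_outer d : d \in outer ->
  [set d' in outer | connect e d.1 d'.1] = facial_walk rot d.
Proof. by case: emb => _ _ _ h _; apply: h. Qed.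

Let s2_outer : (s2 \in outer) = (s1 \in outer).
Proof.
have W : facial_walk rot s2 = facial_walk rot s1 by rewrite -fs1 walk_step.
apply/idP/idP => sO.
  suff : s1 \in facial_walk rot s2 by rewrite -walk_outer // inE => /andP[].
  by rewrite W inE connect0.
suff : s2 \in facial_walk rot s1 by rewrite -walk_outer // inE => /andP[].
by rewrite -W inE connect0.
Qed.

(** The new outer face is [byp outer]: it is rerouted along [m] if the side of [v] that receives the
    chord was outer too, and is unchanged otherwise. *)
Lemma outerplanar_add_chord : outerplanar (add_edge e a b).
Proof.
have [_ _ outA _ outN] := emb.
have mO : m \notin outer by apply: contraNN mA; apply: (subsetP outA).
exists chord_rot, (byp outer); split.
- exact: chord_rotation.
- exact: chord_genus0.
- rewrite dartsE' /byp /bypass; case: ifP => _; last by rewrite subsetU // outA orbT.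
  rewrite subUset sub1set !inE eqxx orbT /=.
  by apply: subset_trans (subsetDl _ _) _; rewrite subsetU // outA orbT.
(* In the component of [b], both sides undergo the same exchange of darts; in any other component
   nothing changes. *)
- have main d : d \in outer ->
    [set d' in byp outer | connect e' d.1 d'.1] = byp (facial_walk rot d).
    move=> dO; rewrite -walk_outer //; apply/setP => x; rewrite inE chord_connect.
    rewrite /byp /bypass inE; have [s1O|s1O] := boolP (s1 \in outer); last by rewrite inE.
    rewrite andTb -[s1.1]/b; have [cb|cb] := boolP (connect e d.1 b).
      have [->|xm] := eqVneq x m; first by rewrite !in_setU1 eqxx cb.
      by rewrite !in_setU1 !in_setD (negPf xm) [x \in [set d' in outer | _]]in_set andbA.
    rewrite in_setU1 in_setD [RHS]inE.
    have [->|xm] := eqVneq x m; first by rewrite (negPf mO) [connect _ _ _](negPf cb).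
    have [xs|//] := boolP (x \in [set s1; s2]).
    apply/esym/negbTE; rewrite negb_and; apply/orP; right; apply: contraNN cb.
    case/set2P: xs => -> //= dv; exact: connect_trans dv (connect1 evb).
  move=> d; rewrite {1}/byp {1}/bypass; case: ifP => s1O.
    rewrite in_setU1 => /predU1P[-> | /setDP[dO ds]].
      by rewrite walk_m -main.
    by rewrite walk_old ?main // (subsetP outA).
  move=> dO; rewrite walk_old ?main // ?(subsetP outA) //.
  rewrite in_set2 negb_or; apply/andP; split.
    by apply: contraFneq s1O => <-.
  by apply: contraFneq s1O => ds; rewrite -s2_outer -ds.
(* Only [b] and [v] can lose an outer dart; [b] gains [m], and [v] keeps [(v, b)]. *)
move=> z; rewrite chord_isolated => /outN[u zuO].
rewrite /byp /bypass; case: ifP => s1O; last by exists u.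
have [->|zb] := eqVneq z b; first by exists a; rewrite in_setU1 eqxx.
have [->|zv] := eqVneq z v.
  exists b; rewrite in_setU1 in_setD vb_outer andbT in_set2 !xpair_eqE.
  by rewrite (negPf vb) [b == a]eq_sym (negPf ab) eqxx.
by exists u; rewrite in_setU1 in_setD zuO in_set2 !xpair_eqE (negPf zb) (negPf zv) orbT.
Qed.

End Chord.

Lemma deg2_neighbors_adjacent (T : finType) (e : rel T) (v a b : T) :
  symmetric e -> irreflexive e -> maximal_outerplanar e ->
  #|neighbors e v| = 2 -> e v a -> e v b -> a != b -> e a b.
Proof.
move=> e_sym e_irr [[rot [outer emb]] e_max] v2 va vb ab.
have Nv : neighbors e v = [set a; b].
  apply/esym/eqP; rewrite eqEcard cards2 ab v2 andbT.
  by apply/subsetP => u /set2P[]->; rewrite inE.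
have [//|nab] := boolP (e a b); exfalso.
have [_ _ outA _ outN] := emb.
have [u vu] : exists u, (v, u) \in outer.
  by apply: outN; rewrite -card_gt0 v2.
(* The chord is drawn on the side of [v] that leaves the dart [(v, u)] outer, so [a] and [b]
   exchange roles when [u] is [a]. *)
have /set2P[uE|uE] : u \in [set a; b].
- by rewrite -Nv inE; have := subsetP outA _ vu; rewrite inE.
- rewrite eq_sym in ab; rewrite e_sym in nab; rewrite setUC in Nv; rewrite uE in vu.
  apply: (e_max b a ab nab).
  exact: (outerplanar_add_chord e_sym e_irr emb Nv ab nab vu).
rewrite uE in vu; apply: (e_max a b ab nab).
exact: (outerplanar_add_chord e_sym e_irr emb Nv ab nab vu).
Qed.

(** * Counting vertices of degree 2 along a forcing process *)

Lemma zero_forcing_deg2 (T : finType) (e : rel T) (S : {set T}) :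
  symmetric e ->
  (forall v a b, #|neighbors e v| = 2 -> e v a -> e v b -> a != b -> e a b) ->
  zero_forcing_set e S -> num_deg2 e <= #|S|.*2.
Proof.
move=> e_sym adj; set L := [set v | #|neighbors e v| == 2].
(* [F] is the set of the vertices that have forced a neighbor. *)
pose inv (B : {set T}) := exists F : {set T},
  [/\ F \subset B, #|B| = #|S| + #|F|,
      forall x, x \in F -> neighbors e x \subset B,
      forall x, x \in B :\: S -> exists2 u, u \in F & e u x
    & forall x, x \in L -> x \in B :\: S -> x \notin F].
have inv_step B B' : force_step e B B' -> inv B -> inv B'.
  case/existsP => v /andP[vB /existsP[w /andP[/eqP Nv /eqP->]]] [F [FB cB FN Bu LF]].
  have /setDP[vw wB] : w \in neighbors e v :\: B by rewrite Nv set11.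
  have vF : v \notin F by apply: contraNN wB => /FN/subsetP; apply.
  exists (v |: F); split.
  - by rewrite subUset sub1set in_setU1 vB orbT subsetU // FB orbT.
  - by rewrite !cardsU1 vF wB cB addnCA.
  - move=> x /setU1P[-> | /FN xB]; last by rewrite subsetU // xB orbT.
    by apply/subsetP => y vy; rewrite in_setU1 -in_set1 -Nv in_setD vy andbT orNb.
  - move=> x; rewrite in_setD in_setU1 => /andP[xS /predU1P[-> | xB]].
      by exists v; rewrite ?setU11 //; rewrite inE in vw.
    have [|u uF ux] := Bu x; first by rewrite in_setD xS.
    by exists u => //; rewrite in_setU1 uF orbT.
  move=> x xL; rewrite in_setD in_setU1 => /andP[xS /predU1P[-> | xB]].
    rewrite in_setU1 negb_or; apply/andP; split.
      by apply: contraNneq wB => ->.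
    by apply: contraNN wB; apply: subsetP.
  have xBS : x \in B :\: S by rewrite in_setD xS.
  (* If the forcing vertex [v] were [x], the vertex [u] that forced [x] would be adjacent to [w] by
     [adj]; but [u] has already forced, so all its neighbors are blue. *)
  rewrite in_setU1 negb_or LF // andbT; apply: contraNneq wB => xv.
  have [u uF ux] := Bu x xBS; have [->|uw] := eqVneq w u; first exact: (subsetP FB).
  apply: (subsetP (FN u uF)); rewrite inE.
  move: xL vw; rewrite !inE -xv => /eqP x2 xw.
  by apply: (adj x) => //; rewrite 1?eq_sym // e_sym.
have inv0 : inv S.
  exists set0; split; rewrite ?sub0set ?cards0 ?addn0 //.
  - by move=> x; rewrite inE.
  - by move=> x; rewrite setDv inE.
  by move=> x _; rewrite setDv inE.
rewrite /zero_forcing_set => /connectP[p].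
have invE B : path (force_step e) B p -> inv B -> inv (last B p).
  by elim: p B => //= B' p IHp B /andP[/inv_step BB' /IHp]; auto.
move=> /invE/(_ inv0) + pT; rewrite -pT => -[F [_ cT _ _ LF]].
(* Each step adds one blue vertex and one forcing vertex, so once all of [T] is blue exactly [#|S|]
   vertices lie outside [F]. *)
have LSF : L \subset S :|: ~: F.
  apply/subsetP => x xL; rewrite in_setU in_setC; have [//|xS] := boolP (x \in S).
  by apply: LF; rewrite // in_setD xS in_setT.
apply: leq_trans (subset_leq_card LSF) _; apply: leq_trans (leq_card_setU _ _) _.
by rewrite -addnn leq_add2l -(leq_add2r #|F|) -cT cardsT addnC cardsC.
Qed.

Theorem theorem2p7 (T : finType) (e : rel T)
    (e_sym : symmetric e) (e_irr : irreflexive e)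
    (e_mop : maximal_outerplanar e)
    (rot : T -> {perm T}) (outer : {set T * T})
    (emb : outerplane_embedding e rot outer)
    (t_gt0 : 1 <= #|separator_triangles e rot outer|)
    (Gtri_conn : Gtri_components e rot outer = 1) :
  uphalf (num_deg2 e) <= zero_forcing_number e.
Proof.
rewrite leq_uphalf_double /zero_forcing_number.
case: arg_minnP => [|S S_zf _]; first exact: connect0.
apply: (zero_forcing_deg2 e_sym _ S_zf) => v a b.
exact: deg2_neighbors_adjacent.
Qed.
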